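(* Let $G=(V,E)$ be a finite graph with $E\neq\emptyset$. Then the integrality gap of the vertex cover LP relaxation satisfies \[\rho(G)=2-\frac{2}{\chi^f(G)},\] where $\chi^f(G)$ is the fractional chromatic number of $G$.
   Context: For a finite graph $G=(V,E)$, let $IP(G)$ be the convex hull of the feasible solutions of the integer program $x_u+x_v\ge 1$ for all $\{u,v\}\in E$, $x\in\mathbb{Z}_+^V$ (i.e., the convex hull of indicator vectors of vertex covers, together with all integer vectors dominating them), and let $P(G)=\{x\in\mathbb{R}^V: x_u+x_v\ge 1\ \forall \{u,v\}\in E,\ x_v\ge 0\ \forall v\in V\}$ be its linear programming relaxation. The integrality gap is \[\rho(G)=\max_{c:V\to\mathbb{R}_+}\frac{\min\{c^Tx: x\in IP(G)\}}{\min\{c^Tx: x\in P(G)\}}.\] Let $\mathcal{U}(G)$ be the set of independent sets of $G$. The fractional chromatic number $\chi^f(G)$ is the optimal value of the linear program: minimize $\sum_{U\in\mathcal{U}(G)} y_U$ subject to $\sum_{U\in\mathcal{U}(G): v\in U} y_U\ge 1$ for all $v\in V$ and $y_U\ge 0$ for all $U\in\mathcal{U}(G)$. *)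

(* Defs.v *)
From mathcomp Require Import all_boot all_order all_algebra.
From mathcomp Require Import boolp classical_sets reals convex.

Set Implicit Arguments.
Unset Strict Implicit.
Unset Printing Implicit Defensive.

Import Order.TTheory GRing.Theory Num.Theory.

Local Open Scope classical_set_scope.
Local Open Scope ring_scope.

(* A finite graph is a finType V of vertices with a symmetric irreflexive
   adjacency relation e : rel V; points of R^V are finite functions. *)

(* The values below are 0 when the extremum is not attained. *)
Definition min_of (R : realType) (A : set R) : R :=
  xget 0 [set m | A m /\ lbound A m].

Definition max_of (R : realType) (A : set R) : R :=
  xget 0 [set m | A m /\ ubound A m].

(* R^o makes R a module over itself, whence the pointwise module R^V. *)
Definition convex_hull (R : realType) (V : finType)
    (A : set {ffun V -> R}) : set {ffun V -> R} :=
  smallest (fun B : set (convex_lmodType {ffun V -> R^o}) => convex_set B) A.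

Section VertexCover.
Variables (R : realType) (V : finType) (e : rel V).

Definition vc_polyhedron : set {ffun V -> R} :=
  [set x | (forall u v, e u v -> 1 <= x u + x v) /\ (forall v, 0 <= x v)].

Definition vc_integer_points : set {ffun V -> R} :=
  [set x | (forall u v, e u v -> 1 <= x u + x v) /\
           (forall v, x v \is a Num.nat)].

Definition vc_integer_hull : set {ffun V -> R} :=
  convex_hull vc_integer_points.

Definition min_cost (c : {ffun V -> R}) (A : set {ffun V -> R}) : R :=
  min_of [set \sum_v c v * x v | x in A].

(* Costs whose relaxed optimum is 0, e.g. c = 0, give the undefined ratio 0/0
   and are left out. *)
Definition integrality_gap : R :=
  max_of [set min_cost c vc_integer_hull / min_cost c vc_polyhedron
         | c in [set c : {ffun V -> R} | (forall v, 0 <= c v) /\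
                                         0 < min_cost c vc_polyhedron]].

End VertexCover.

Section FractionalChromaticNumber.
Variables (R : realType) (V : finType) (e : rel V).

Definition independent (U : {set V}) : bool :=
  [forall u in U, forall v in U, ~~ e u v].

(* Weights on sets U that are not independent are unconstrained, but they
   occur neither in the covering constraints nor in the objective. *)
Definition fractional_colouring : set {ffun {set V} -> R} :=
  [set y | (forall v, 1 <= \sum_(U | independent U && (v \in U)) y U) /\
           (forall U, independent U -> 0 <= y U)].

Definition fractional_chromatic_number : R :=
  min_of [set \sum_(U | independent U) y U | y in fractional_colouring].

End FractionalChromaticNumber.

(* Main.v *)
Require Import Defs.
From mathcomp Require Import all_boot all_order all_algebra.
From mathcomp Require Import boolp classical_sets reals convex.
From mathcomp Require Import interval_inference ring lra.

(* Upper bound: the relaxation has a half-integral optimum [h]. Drawing an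
   independent set [U] from an optimal fractional colouring of weight [chi],
   the vertex cover [{h = 1} + ({h = 1/2} - U)] costs on average at most
   [2 - 2 / chi] times [h].
   Lower bound: an optimal dual solution [z] of the colouring program is a
   vertex weighting of total weight [chi] in which every independent set weighs
   at most [1]. With costs [z] every vertex cover costs at least [chi - 1],
   because its complement is independent, whereas the constant vector [1/2]
   costs [chi / 2]. *)

Set Implicit Arguments.
Unset Strict Implicit.
Unset Printing Implicit Defensive.

Import Order.TTheory GRing.Theory Num.Theory.

Local Open Scope ring_scope.

(** * Farkas' lemma and duality of covering and packing programs *)

Section Duality.
Variable R : realFieldType.

Lemma sum_subMl (J : finType) (f h x : J -> R) (t : R) :
  \sum_j (f j - t * h j) * x j = \sum_j f j * x j - t * \sum_j h j * x j.
Proof.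
by rewrite mulr_sumr -sumrB; apply: eq_bigr => j _; rewrite mulrBl mulrA.
Qed.

Lemma sum_subMr (J : finType) (f x y : J -> R) (t : R) :
  \sum_j f j * (x j - t * y j) = \sum_j f j * x j - t * \sum_j f j * y j.
Proof.
by rewrite mulr_sumr -sumrB; apply: eq_bigr => j _; rewrite mulrBr mulrCA.
Qed.

(* Bartl's induction: if the constraint [k] is needed, some [x0] violates
   [g] but only the constraint [k]; projecting along [x0] onto the kernel of
   [a k] eliminates [k]. *)
Lemma farkas_on (I J : finType) (S : {set I}) (a : I -> J -> R) (g : J -> R) :
  (forall x : J -> R, (forall i, i \in S -> \sum_j a i j * x j <= 0) ->
    \sum_j g j * x j <= 0) ->
  exists2 l : I -> R, (forall i, 0 <= l i) &
    forall j, g j = \sum_(i in S) l i * a i j.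
Proof.
have [n] := ubnP #|S|; elim: n => // n IHn in S a g * => ltSn Sg.
have [S0|[k kS]] := set_0Vmem S.
  exists (fun=> 0) => // j; rewrite S0 big_set0.
  (* Without constraints, testing at [x = g] bounds the sum of the squares of [g] by [0]. *)
  have /Sg sqr : forall i, i \in S -> \sum_j a i j * g j <= 0.
    by move=> i; rewrite S0 inE.
  have sq0 i : true -> 0 <= g i * g i by rewrite -expr2 sqr_ge0.
  have /eqP : \sum_i g i * g i = 0 by apply/eqP; rewrite eq_le sqr sumr_ge0.
  rewrite psumr_eq0// => /allP/(_ j (mem_index_enum _)).
  by rewrite mulf_eq0 orbb => /eqP.
have ltS'n : (#|S :\ k| < n)%N by move: ltSn; rewrite (cardsD1 k) kS.
have [S'g|] := pselect (forall x : J -> R,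
    (forall i, i \in S :\ k -> \sum_j a i j * x j <= 0) ->
    \sum_j g j * x j <= 0).
  have [l l0 gE] := IHn _ _ _ ltS'n S'g.
  exists (fun i => if i == k then 0 else l i) => [i|j]; first by case: ifP.
  rewrite (big_setD1 k)//= eqxx mul0r add0r gE.
  by apply: eq_bigr => i; rewrite !inE => /andP[/negPf->].
move=> /existsNP[x0 /not_implyP[ax0 /negP]]; rewrite -ltNge => gx0.
have t0 : 0 < \sum_j a k j * x0 j.
  rewrite ltNge; apply/negP => kx0; move: gx0; rewrite ltNge Sg// => i iS.
  by have [->//|ik] := eqVneq i k; apply: ax0; rewrite !inE ik.
set t := \sum_j _ in t0.
pose p (f : J -> R) := (\sum_j f j * x0 j) / t.
have [|l l0 gE] := IHn _ (fun i j => a i j - p (a i) * a k j)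
    (fun j => g j - p g * a k j) ltS'n.
  move=> x ax; rewrite sum_subMl.
  set u := \sum_j a k j * x j.
  (* Evaluating the projected functionals at [x] amounts to evaluating the original ones at
     [x - (u / t) x0], a point where [a k] vanishes. *)
  have swap f : p f * u = u / t * \sum_j f j * x0 j by rewrite /p; ring.
  rewrite swap -sum_subMr; apply: Sg => i iS.
  have [->|ik] := eqVneq i k.
    by rewrite sum_subMr -/t -/u divfK ?subrr ?gt_eqF.
  by rewrite sum_subMr -swap -sum_subMl ax// !inE ik.
(* The multiplier of [k] collects all multiples of [a k] in the projected identity. It is
   nonnegative because [x0] makes [p g] positive and [p (a i)] nonpositive for the other [i]. *)
exists (fun i =>
  if i == k then p g - \sum_(i in S :\ k) l i * p (a i) else l i).
  move=> i; case: ifP => // _; rewrite subr_ge0.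
  apply: (@le_trans _ _ 0); last by rewrite divr_ge0 ?ltW.
  apply: sumr_le0 => m mS; rewrite mulr_ge0_le0//.
  by rewrite pmulr_lle0 ?invr_gt0// ax0.
move=> j; rewrite (big_setD1 k)//= eqxx.
have /eqP := gE j; rewrite subr_eq => /eqP->.
rewrite [X in _ = _ + X](eq_bigr (fun i => l i * a i j)); last first.
  by move=> i; rewrite !inE => /andP[/negPf->].
under [in LHS]eq_bigr do rewrite mulrBr mulrA.
by rewrite sumrB -mulr_suml; ring.
Qed.

(** The sign conditions on [x] join the system as rows [- x k <= 0]; their multipliers are the slack
    in the resulting inequality. *)
Lemma farkas (I J : finType) (a : I -> J -> R) (g : J -> R) :
  (forall x : J -> R, (forall j, 0 <= x j) ->
    (forall i, \sum_j a i j * x j <= 0) -> \sum_j g j * x j <= 0) ->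
  exists2 l : I -> R, (forall i, 0 <= l i) &
    forall j, g j <= \sum_i l i * a i j.
Proof.
move=> ag; pose b (s : I + J) j :=
  match s with inl i => a i j | inr k => - (j == k)%:R end.
have [|l l0 gE] := @farkas_on _ _ [set: I + J] b g.
  move=> x bx; apply: ag => [k|i]; last exact: (bx (inl i) (finset.in_setT _)).
  have := bx (inr k) (finset.in_setT _); rewrite (bigD1 k)//= eqxx mulN1r.
  by rewrite big1 ?addr0 ?oppr_le0// => j /negPf->; rewrite oppr0 mul0r.
exists (fun i => l (inl i)) => [i|j]; first exact: l0.
rewrite gE (eq_bigl xpredT) => [|i]; last by rewrite finset.in_setT.
rewrite big_sumType/= gerDl.
by apply: sumr_le0 => k _; rewrite mulrN oppr_le0 mulr_ge0.
Qed.

(** Farkas' lemma solves one system stating both feasibilities together with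
    [\sum_u y u <= \sum_v z v]; weak duality gives the reverse inequality. *)
Lemma covering_packing_duality (V U : finType) (A : V -> U -> R) :
  (forall v u, 0 <= A v u) -> (forall v, exists u, 0 < A v u) ->
  exists (y : U -> R) (z : V -> R),
  [/\ forall u, 0 <= y u, forall v, 0 <= z v,
      forall v, 1 <= \sum_u A v u * y u,
      forall u, \sum_v z v * A v u <= 1 & \sum_u y u = \sum_v z v].
Proof.
move=> A0 A1.
(* Rows carry the unknowns [y u] and [z v]. Columns state covering at [v], packing at [u], and the
   comparison of the two totals. *)
pose a (s : U + V) (j : V + U + unit) : R :=
  match s, j with
  | inl u, inl (inl v) => A v u
  | inl u, inr _ => -1
  | inr v, inl (inr u) => - A v u
  | inr v, inr _ => 1
  | _, _ => 0
  end.
pose g (j : V + U + unit) : R :=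
  match j with inl (inl _) => 1 | inl (inr _) => -1 | inr _ => 0 end.
have [|l l0 gl] := @farkas _ _ a g.
  move=> x x0 ax.
  pose p v := x (inl (inl v)); pose q u := x (inl (inr u)).
  pose t := x (inr tt).
  have un (f : unit -> R) : \sum_i f i = f tt.
    by rewrite (bigD1 tt)//= big1 ?addr0// => -[].
  have pt u : \sum_v A v u * p v <= t.
    have := ax (inl u); rewrite !big_sumType/= un.
    rewrite [X in _ + X + _]big1 => [|i _]; rewrite ?mul0r// addr0 mulN1r.
    by rewrite subr_le0.
  have tq v : t <= \sum_u A v u * q u.
    have := ax (inr v); rewrite !big_sumType/= un.
    rewrite [X in X + _ + _]big1 => [|i _]; rewrite ?mul0r// add0r mul1r addrC.
    by under eq_bigr do rewrite mulNr; rewrite sumrN subr_le0.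
  rewrite !big_sumType/= un mul0r addr0.
  under eq_bigr do rewrite mul1r.
  under [X in _ + X]eq_bigr do rewrite mulN1r.
  rewrite sumrN subr_le0 -/p -/q.
  (* If [t = 0], a positive entry in each row of [A] forces [p = 0]. Otherwise [p] and [q] scaled by
     [1 / t] are a packing and a covering, and weak duality applies. *)
  have [t0|t0] := eqVneq t 0.
    rewrite big1 ?sumr_ge0// => v _.
    have [u Au] := A1 v; apply/eqP; rewrite eq_le [0 <= _]x0 andbT.
    rewrite -(pmulr_rle0 _ Au) -t0; apply: le_trans (pt u).
    rewrite (bigD1 v)//= lerDl sumr_ge0// => w _; rewrite mulr_ge0//; exact: x0.
  have tgt : 0 < t by rewrite lt_neqAle eq_sym t0 x0.
  rewrite -(ler_pM2r tgt) !mulr_suml.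
  apply: (@le_trans _ _ (\sum_v \sum_u p v * (A v u * q u))).
    by apply: ler_sum => v _; rewrite -mulr_sumr ler_wpM2l//; exact: x0.
  rewrite exchange_big/=; apply: ler_sum => u _.
  under eq_bigr do rewrite mulrCA mulrA.
  by rewrite -mulr_suml mulrC ler_wpM2l//; exact: x0.
exists (fun u => l (inl u)), (fun v => l (inr v)).
have yz : forall v, 1 <= \sum_u A v u * l (inl u).
  move=> v; have := gl (inl (inl v)); rewrite big_sumType/=.
  rewrite [X in _ + X]big1 => [|i _]; rewrite ?mulr0// addr0.
  by under eq_bigr do rewrite mulrC.
have zu : forall u, \sum_v l (inr v) * A v u <= 1.
  move=> u; have := gl (inl (inr u)); rewrite big_sumType/=.
  rewrite [X in X + _]big1 => [|i _]; rewrite ?mulr0// add0r.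
  by under eq_bigr do rewrite mulrN; rewrite sumrN lerN2.
split=> //.
apply/eqP; rewrite eq_le; apply/andP; split.
  have := gl (inr tt); rewrite big_sumType/=.
  under eq_bigr do rewrite mulrN1.
  under [X in _ + X]eq_bigr do rewrite mulr1.
  by rewrite sumrN addrC subr_ge0.
apply: (@le_trans _ _ (\sum_v \sum_u l (inr v) * (A v u * l (inl u)))).
  by apply: ler_sum => v _; rewrite -mulr_sumr -[leLHS]mulr1 ler_wpM2l.
rewrite exchange_big/=; apply: ler_sum => u _.
under eq_bigr do rewrite mulrA.
by rewrite -mulr_suml -[leRHS]mul1r ler_wpM2r.
Qed.

End Duality.

(** * Attained extrema *)

Lemma min_ofE (R : realType) (A : set R) (m : R) :
  A m -> lbound A m -> min_of A = m.
Proof.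
move=> Am lm; apply: xget_unique => // n [An ln].
by apply/eqP; rewrite eq_le lm// ln.
Qed.

Lemma max_ofE (R : realType) (A : set R) (m : R) :
  A m -> ubound A m -> max_of A = m.
Proof.
move=> Am um; apply: xget_unique => // n [An un].
by apply/eqP; rewrite eq_le um// un.
Qed.

Lemma exists_minimizer (R : realDomainType) (T : finType) (P : pred T)
    (f : T -> R) (x0 : T) :
  P x0 -> exists2 x, P x & forall y, P y -> f x <= f y.
Proof. by move=> Px0; case: (arg_minP f Px0) => x Px fx; exists x. Qed.

Lemma le_convex_comb (R : realDomainType) (M t a b : R) :
  0 <= t -> t <= 1 -> M <= a -> M <= b -> M <= t * a + (1 - t) * b.
Proof. by move=> *; nra. Qed.

(** * Optima over the integer hull and over the relaxation *)

Section VertexCover.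
Variables (R : realType) (V : finType) (e : rel V).
Implicit Types (c x : {ffun V -> R}) (C : {set V}).

Definition vertex_cover C : bool :=
  [forall u, forall v, e u v ==> (u \in C) || (v \in C)].

Lemma vertex_coverP C :
  reflect (forall u v, e u v -> u \in C \/ v \in C) (vertex_cover C).
Proof.
apply: (iffP forallP) => [Ce u v euv|Ce u].
  by apply/orP; move: euv; apply/implyP; move: v; apply/forallP.
by apply/forallP => v; apply/implyP => /Ce/orP.
Qed.

(** The half-space of points costing at least a cheapest cover is convex. It contains every integer
    point, since the support of such a point is a cover that costs no more. *)
Lemma min_cost_integer_hull c : (forall v, 0 <= c v) ->
  (exists2 C, vertex_cover C &
    min_cost c (vc_integer_hull e) = \sum_(v in C) c v) /\
  (forall C, vertex_cover C ->
    min_cost c (vc_integer_hull e) <= \sum_(v in C) c v).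
Proof.
move=> c0.
have /(exists_minimizer (fun C => \sum_(v in C) c v))[C0 C0cov C0min] :
    vertex_cover [set: V]%SET.
  by apply/vertex_coverP => u v _; left; rewrite finset.in_setT.
suff -> : min_cost c (vc_integer_hull e) = \sum_(v in C0) c v.
  by split=> //; exists C0.
apply: min_ofE.
  exists [ffun v => (v \in C0)%:R].
    apply: sub_gen_smallest; split=> [u v|v]; rewrite !ffunE ?natr_nat//.
    by move/vertex_coverP: C0cov => /[apply] -[->|->]; rewrite ?lerDl ?lerDr.
  rewrite [RHS]big_mkcond; apply: eq_bigr => v _; rewrite ffunE.
  by case: ifP; rewrite ?mulr1 ?mulr0.
move=> _ [x xhull <-].
pose B : set {ffun V -> R} :=
  [set x | \sum_(v in C0) c v <= \sum_v c v * x v]%classic.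
apply: (smallest_sub (X := B) _ _ xhull) => [y z t|y [ye yN]].
  rewrite !inE /B/= => By Bz.
  rewrite [X in _ <= X](_ : _ = t%:num * (\sum_v c v * y v)
      + (1 - t%:num) * (\sum_v c v * z v)).
    exact: le_convex_comb.
  rewrite !mulr_sumr -big_split; apply: eq_bigr => v _ /=.
  by rewrite !ffunE mulrDr; congr (_ + _); exact: mulrCA.
pose C := [set v | 1 <= y v]%SET.
have Ccov : vertex_cover C.
  apply/vertex_coverP => u v /ye; rewrite !inE.
  have /natrP[m ->] := yN u; have /natrP[n ->] := yN v.
  by rewrite -natrD !ler1n; case: m n => [|m] [|n] //= _; [right|left|left].
apply: le_trans (C0min _ Ccov) _; rewrite big_mkcond.
apply: ler_sum => v _; rewrite inE; case: ifP => y1.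
  by rewrite -[leLHS]mulr1 ler_wpM2l.
by rewrite mulr_ge0// natr_ge0.
Qed.

Definition half_integral x := forall v, x v \in [:: 0; 2^-1; 1].

(* With [t] the least value of [min (x v) (1 - x v)] off [{0, 1/2, 1}], the
   point [x] is the convex combination [2 t h + (1 - 2 t) x'] of a half-integral
   point [h] and of a feasible [x'] having fewer coordinates off
   [{0, 1/2, 1}]. *)
Lemma half_integral_bound c (M : R) :
  (forall h, vc_polyhedron e h -> half_integral h -> M <= \sum_v c v * h v) ->
  forall x, vc_polyhedron e x -> (forall v, x v <= 1) ->
    M <= \sum_v c v * x v.
Proof.
move=> Mh x; pose F x := [pred v | x v \notin [:: 0; 2^-1; 1 : R]].
have [n] := ubnP #|F x|; elim: n => // n IHn in x * => ltFn [xe x0] x1.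
have [F0|/pred0Pn[w0 Fw0]] := eqVneq #|F x| 0%N.
  apply: Mh => // v; move: (card0_eq F0 v); rewrite inE => /negbT.
  by rewrite negbK.
pose m v := Num.min (x v) (1 - x v).
have [w Fw mw] := exists_minimizer m Fw0.
set t := m w in mw.
have t_gt0 : 0 < t.
  move: Fw; rewrite !inE !negb_or => /and3P[w1 _ w2].
  by rewrite /t /m lt_min lt_neqAle eq_sym w1 x0 subr_gt0 lt_neqAle w2 x1.
have t_lt : t < 2^-1.
  move: Fw; rewrite !inE !negb_or => /and3P[_ w1 _].
  by rewrite /t /m gt_min; case: ltgtP w1 => //= ? _; lra.
have Fm v : x v \notin [:: 0; 2^-1; 1] -> t <= x v /\ x v <= 1 - t.
  move=> /mw; rewrite /m le_min => /andP[-> ?]; split=> //; lra.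
pose h := [ffun v => if x v == 0 then 0 else if x v == 1 then 1 else 2^-1 : R].
pose x' := [ffun v => (x v - 2 * t * h v) / (1 - 2 * t)].
have d0 : 0 < 1 - 2 * t by lra.
have xt v : [\/ [/\ x v = 0, h v = 0 & x' v = 0],
    [/\ x v = 1, h v = 1 & x' v = 1] |
    [/\ (x v == 0) || (x v == 1) = false, h v = 2^-1,
        x' v = (x v - t) / (1 - 2 * t),
        t <= x v & x v <= 1 - t]].
  rewrite !ffunE; have [->|x_0] := eqVneq (x v) 0.
    by apply: Or31; rewrite mulr0 subr0 mul0r.
  have [->|x_1] := eqVneq (x v) 1.
    by apply: Or32; rewrite mulr1 divff ?gt_eqF.
  have -> : 2 * t / 2 = t by field.
  have [tx xt] : t <= x v /\ x v <= 1 - t.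
    have [->|x_2] := eqVneq (x v) 2^-1; first by lra.
    by apply: Fm; rewrite !inE !negb_or x_0 x_2 x_1.
  by apply: Or33.
have hP : vc_polyhedron e h.
  split=> [u v /xe|v].
    by case: (xt u) => [[-> -> _]|[-> -> _]|[_ -> _ ? ?]];
      case: (xt v) => [[-> -> _]|[-> -> _]|[_ -> _ ? ?]]; lra.
  by case: (xt v) => [[_ -> _]|[_ -> _]|[_ -> _ ? ?]]; lra.
have x'0 v : 0 <= x' v.
  case: (xt v) => [[_ _ ->]|[_ _ ->]|[_ _ -> ? _]]; rewrite ?ler01//.
  by rewrite divr_ge0 ?subr_ge0 //; lra.
(* A coordinate [0] of [x] forces its neighbours to be [1], as the others are at most [1 - t < 1].
   For two coordinates strictly between [0] and [1], the constraint at [x'] is equivalent to that at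
   [x]. *)
have x'P : vc_polyhedron e x'.
  split=> // u v /xe; have := x'0 u; have := x'0 v.
  case: (xt u) => [[-> _ ->]|[_ _ ->]|[_ _ -> ? ?]];
    case: (xt v) => [[-> _ ->]|[_ _ ->]|[_ _ -> ? ?]]; try lra.
  by move=> _ _ ?; rewrite -mulrDl ler_pdivlMr//; lra.
have x'1 v : x' v <= 1.
  case: (xt v) => [[_ _ ->]|[_ _ ->]|[_ _ -> _ ?]]; rewrite ?ler01//.
  by rewrite ler_pdivrMr//; lra.
have /IHn/(_ x'P x'1) Mx' : (#|F x'| < n)%N.
  rewrite ltnS in ltFn; apply: leq_trans ltFn; apply/proper_card/properP; split.
    apply/fintype.subsetP => v; rewrite !inE; apply: contra.
    case: (xt v) => [[-> _ ->]|[-> _ ->]|[x01 _ -> _ _]] //=.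
    rewrite orbCA x01 orbF => /eqP->.
    by apply/or3P/Or32/eqP; field; lra.
  (* The coordinate [w] attaining [t] is pushed to [0] or [1], so the count drops strictly. *)
  exists w => //; rewrite !inE negbK.
  case: (xt w) => [[_ _ ->]|[_ _ ->]|[_ _ -> _ _]]; rewrite ?eqxx ?orbT//.
  have [xw|xw] : x w = t \/ x w = 1 - t.
    by rewrite /t /m minEle; case: ifP => _; [left|right] => //; lra.
  - by rewrite xw subrr mul0r eqxx.
  - rewrite xw (_ : 1 - t - t = 1 - 2 * t); last by ring.
    by rewrite divff ?(gt_eqF d0)// eqxx !orbT.
have Mh' : M <= \sum_v c v * h v.
  apply: Mh => // v; rewrite !inE.
  by case: (xt v) => [[_ -> _]|[_ -> _]|[_ -> _ _ _]]; rewrite eqxx ?orbT.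
have -> : \sum_v c v * x v = 2 * t * (\sum_v c v * h v)
    + (1 - 2 * t) * (\sum_v c v * x' v).
  rewrite !mulr_sumr -big_split; apply: eq_bigr => v _ /=.
  by rewrite [x' v]ffunE; field; rewrite gt_eqF.
by apply: le_convex_comb => //; lra.
Qed.

(** Half-integral points with values in [{0, 1/2, 1}] are coded by maps to ['I_3], so a cheapest
    feasible one exists. Capping coordinates at [1] keeps feasibility and does not raise the cost,
    which extends [half_integral_bound] to the whole polyhedron. *)
Lemma min_cost_polyhedron c : (forall v, 0 <= c v) ->
  (exists h, [/\ vc_polyhedron e h, half_integral h &
    min_cost c (vc_polyhedron e) = \sum_v c v * h v]) /\
  (forall x, vc_polyhedron e x ->
    min_cost c (vc_polyhedron e) <= \sum_v c v * x v).
Proof.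
move=> c0.
pose half (f : {ffun V -> 'I_3}) : {ffun V -> R} := [ffun v => (f v)%:R / 2].
have [|f fP fmin] := @exists_minimizer R {ffun V -> 'I_3}
    (fun f => `[< vc_polyhedron e (half f) >])
    (fun f => \sum_v c v * half f v) [ffun => ord_max].
  by apply/asboolP; split=> [u v _|v]; rewrite !ffunE//=; lra.
have {}fmin h : vc_polyhedron e h -> half_integral h ->
    \sum_v c v * half f v <= \sum_v c v * h v.
  move=> hP hH.
  have /choice[k hk] v : exists k : 'I_3, h v = k%:R / 2.
    move: (hH v); rewrite !inE => /or3P[]/eqP->.
    - by exists ord0; rewrite mul0r.
    - by exists (Ordinal (isT : (1 < 3)%N)); rewrite mul1r.
    - by exists ord_max; rewrite divff ?pnatr_eq0.
  have hE : h = half (finfun k) by apply/ffunP => v; rewrite !ffunE.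
  by rewrite hE; apply: fmin; rewrite -hE; apply/asboolP.
have lb x : vc_polyhedron e x -> \sum_v c v * half f v <= \sum_v c v * x v.
  move=> [xe x0]; pose x1 := [ffun v => Num.min (x v) 1].
  apply: (@le_trans _ _ (\sum_v c v * x1 v)).
    apply: half_integral_bound => // [|v]; last first.
      by rewrite ffunE ge_min lexx orbT.
    split=> [u v /xe|v]; rewrite !ffunE ?le_min ?x0 ?ler01//.
    by have := x0 u; have := x0 v; rewrite !minEle; do 2!case: ifP; lra.
  by apply: ler_sum => v _; rewrite ffunE ler_wpM2l// ge_min lexx.
suff -> : min_cost c (vc_polyhedron e) = \sum_v c v * half f v.
  split=> //; exists (half f); split=> //; first exact/asboolP.
  move=> v; rewrite ffunE !inE; case: (f v) => -[|[|[]]]//= _.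
  - by rewrite mul0r eqxx.
  - by rewrite mul1r eqxx orbT.
  - by rewrite divff ?pnatr_eq0// eqxx !orbT.
apply: min_ofE => [|_ [x xP <-]]; last exact: lb.
by exists (half f) => //; exact/asboolP.
Qed.

End VertexCover.

(** * Fractional colourings, their dual, and the upper bound on the gap *)

Section FractionalChromaticNumber.
Variables (R : realType) (V : finType) (e : rel V).
Hypothesis e_irr : irreflexive e.

Lemma independentP (U : {set V}) :
  reflect {in U &, forall u v, ~~ e u v} (independent e U).
Proof.
apply: (iffP forall_inP) => [Ue u v uU vU|Ue u uU].
  by move/forall_inP: (Ue u uU); apply.
by apply/forall_inP => v vU; exact: Ue.
Qed.

Lemma fractional_chromatic_duality :
  exists (y : {ffun {set V} -> R}) (z : {ffun V -> R}),
  [/\ fractional_colouring e y, forall v, 0 <= z v,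
      forall U, independent e U -> \sum_(v in U) z v <= 1,
      \sum_(U | independent e U) y U = fractional_chromatic_number R e &
      \sum_v z v = fractional_chromatic_number R e].
Proof.
(* All subsets index the columns, those of dependent sets being zero; singletons, independent by
   irreflexivity, give each row a positive entry. *)
pose A v (U : {set V}) : R := (independent e U && (v \in U))%:R.
have sumA (y : {set V} -> R) v :
    \sum_U A v U * y U = \sum_(U | independent e U && (v \in U)) y U.
  rewrite [RHS]big_mkcond; apply: eq_bigr => U _; rewrite /A.
  by case: ifP; rewrite ?mul1r ?mul0r.
have [||y [z [y0 z0 yA zA yz]]] := @covering_packing_duality R V {set V} A.
- by move=> v U; exact: ler0n.
- move=> v; exists [set v]%SET; rewrite /A set11 andbT ltr0n lt0b.
  by apply/independentP => u w; rewrite !inE => /eqP-> /eqP->; rewrite e_irr.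
have zU U : independent e U -> \sum_(v in U) z v <= 1.
  move=> Ui; apply: le_trans (zA U); rewrite [leLHS]big_mkcond.
  by apply: ler_sum => v _; rewrite /A Ui; case: ifP; rewrite ?mulr1 ?mulr0.
have weak y' : fractional_colouring e y' ->
    \sum_v z v <= \sum_(U | independent e U) y' U.
  move=> [y'1 y'0].
  apply: (@le_trans _ _
    (\sum_v \sum_(U | independent e U && (v \in U)) z v * y' U)).
    by apply: ler_sum => v _; rewrite -mulr_sumr -[leLHS]mulr1 ler_wpM2l.
  rewrite (exchange_big_dep (independent e))/=; last by move=> ? ? _ /andP[].
  apply: ler_sum => U Ui; rewrite Ui/= -mulr_suml -[leRHS]mul1r.
  rewrite ler_wpM2r ?y'0//.
  exact: zU.
have yP : fractional_colouring e (finfun y).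
  split=> [v|U _]; last by rewrite ffunE.
  by under eq_bigr do rewrite ffunE; rewrite -sumA.
have yE : \sum_(U | independent e U) finfun y U = \sum_v z v.
  (* Discarding the weight of dependent sets can only lower the total, and weak duality prevents it
     from dropping. *)
  apply/eqP; rewrite eq_le weak// andbT -yz [leRHS](bigID (independent e))/=.
  under eq_bigr do rewrite ffunE.
  by rewrite lerDl sumr_ge0.
have chiE : fractional_chromatic_number R e = \sum_v z v.
  apply: min_ofE => [|_ [y' y'P <-]]; last exact: weak.
  by exists (finfun y).
exists (finfun y), (finfun z).
split=> //; first by move=> v; rewrite ffunE.
- by move=> U Ui; under eq_bigr do rewrite ffunE; exact: zU.
- by rewrite chiE.
- by under eq_bigr do rewrite ffunE.
Qed.

(** No independent set contains both ends of an edge, so the covering constraints at the two ends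
    involve disjoint families of sets and can be added. *)
Lemma fractional_chromatic_number_ge2 :
  (exists u v, e u v) -> 2 <= fractional_chromatic_number R e.
Proof.
move=> [u [v euv]].
have [y [_ [[y1 y0] _ _ <- _]]] := fractional_chromatic_duality.
have := lerD (y1 u) (y1 v); move/le_trans; apply.
rewrite [X in X + _]big_mkcondr [X in _ + X]big_mkcondr -big_split/=.
apply: ler_sum => U Ui; have := y0 U Ui.
case: ifPn => uU; case: ifPn => vU; rewrite ?addr0 ?add0r// => _.
by have /independentP/(_ u v uU vU) := Ui; rewrite euv.
Qed.

Lemma min_cost_integer_hull_le (c : {ffun V -> R}) :
  (exists u v, e u v) -> (forall v, 0 <= c v) ->
  min_cost c (vc_integer_hull e) <=
    (2 - 2 / fractional_chromatic_number R e) * min_cost c (vc_polyhedron e).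
Proof.
move=> e_n0 c0; have chi2 := fractional_chromatic_number_ge2 e_n0.
have [y [_ [[y1 y0] _ _ yE _]]] := fractional_chromatic_duality.
have [_ Imin] := min_cost_integer_hull e c0.
have [[h [[he h0] hH ->]] _] := min_cost_polyhedron e c0.
set chi := fractional_chromatic_number R e in chi2 yE *.
set I := min_cost _ _ in Imin *.
pose C (U : {set V}) :=
  [set v | (h v == 1) || (h v == 2^-1) && (v \notin U)]%SET.
(* An edge with no end at [1] has both ends at [1/2], and [U] misses one of them. *)
have Ccov U : independent e U -> vertex_cover e (C U).
  move=> /independentP Ui; apply/vertex_coverP => u v euv.
  have hle w : h w != 1 -> h w <= 2^-1.
    by have := hH w; rewrite !inE => /or3P[]/eqP->; rewrite ?eqxx// invr_ge0.
  rewrite !inE; have [_|/hle hu] := eqVneq (h u) 1; first by left.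
  have [_|/hle hv] := eqVneq (h v) 1; first by right.
  have huv := he u v euv.
  have -> : h u = 2^-1 by lra.
  have -> : h v = 2^-1 by lra.
  rewrite eqxx/=; apply/orP; rewrite -negb_and; apply/negP => /andP[uU vU].
  by have := Ui u v uU vU; rewrite euv.
have chi0 : 0 < chi by lra.
(* Multiplying by [chi] replaces the probabilities [y U / chi] by the weights [y U]. *)
rewrite -(ler_pM2l chi0).
rewrite [leRHS](_ : _ = \sum_v c v * ((2 * chi - 2) * h v)); last first.
  have -> : chi * ((2 - 2 / chi) * (\sum_v c v * h v))
      = (2 * chi - 2) * (\sum_v c v * h v) by field; lra.
  by rewrite mulr_sumr; apply: eq_bigr => v _; rewrite mulrCA.
apply: (@le_trans _ _
  (\sum_(U | independent e U) \sum_v c v * (y U * (v \in C U)%:R))).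
  rewrite -[in leLHS]yE mulr_suml; apply: ler_sum => U Ui.
  have /(ler_wpM2l (y0 U Ui))/le_trans := Imin _ (Ccov U Ui); apply.
  rewrite mulr_sumr [leLHS]big_mkcond; apply: ler_sum => v _.
  by case: ifP => _; rewrite ?mulr1 ?mulr0 // mulrC.
rewrite exchange_big/=; apply: ler_sum => v _.
rewrite -mulr_sumr ler_wpM2l//.
(* The covers containing [v] have weight [0] if [h v = 0], at most [chi - 1] if [h v = 1/2] by the
   covering constraint at [v], and [chi <= 2 * chi - 2] if [h v = 1]. *)
have := hH v; rewrite !inE => /or3P[]/eqP hv; rewrite hv.
- rewrite mulr0 big1// => U _.
  by rewrite inE hv eq_sym oner_eq0 eq_sym invr_eq0 pnatr_eq0 mulr0.
- have half1 : (2^-1 == 1 :> R) = false by apply/eqP; lra.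
  have : \sum_(U | independent e U) y U * (v \in C U)%:R
      + \sum_(U | independent e U && (v \in U)) y U = chi.
    rewrite [X in _ + X]big_mkcondr -big_split -yE; apply: eq_bigr => U _ /=.
    rewrite inE hv eqxx half1.
    by case: (v \in U); rewrite /= ?mulr0 ?mulr1 ?add0r ?addr0.
  by have := y1 v; lra.
- rewrite mulr1; under eq_bigr do rewrite inE hv eqxx mulr1.
  by rewrite yE; lra.
Qed.

End FractionalChromaticNumber.

(** * The lower bound and the value of the gap *)

Theorem theorem1 (R : realType) (V : finType) (e : rel V)
    (e_sym : symmetric e) (e_irr : irreflexive e)
    (e_nonempty : exists u v : V, e u v) :
  integrality_gap R e = 2 - 2 / fractional_chromatic_number R e.
Proof.
have chi2 := @fractional_chromatic_number_ge2 R _ _ e_irr e_nonempty.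
have ub c := @min_cost_integer_hull_le R _ _ e_irr c e_nonempty.
have [_ [z [_ z0 zU _ zE]]] := fractional_chromatic_duality R e_irr.
set chi := fractional_chromatic_number R e in chi2 ub zE *.
have zub := ub z z0.
have [[C Ccov IE] _] := min_cost_integer_hull e z0.
have [_ Lmin] := min_cost_polyhedron e z0.
have Ichi : chi - 1 <= min_cost z (vc_integer_hull e).
  have Ci : independent e (~: C)%SET.
    apply/independentP => u v; rewrite !inE => uC vC; apply/negP.
    by move/vertex_coverP: Ccov => /[apply] -[]; apply/negP.
  rewrite IE -zE (bigID (mem C))/= -addrA gerDl subr_le0.
  apply: le_trans (zU _ Ci); rewrite le_eqVlt; apply/orP; left; apply/eqP.
  by apply: eq_bigl => v; rewrite inE.
have Lchi : min_cost z (vc_polyhedron e) <= chi / 2.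
  rewrite -zE mulr_suml.
  have /Lmin/le_trans : vc_polyhedron e [ffun=> 2^-1 : R].
    by split=> [u v _|v]; rewrite !ffunE; lra.
  by apply; apply: ler_sum => v _; rewrite ffunE.
set r := 2 - 2 / chi in zub ub *.
(* This identity makes the bounds [Ichi] and [Lchi] meet the upper bound [zub], so the cost [z]
   attains the ratio [r]. *)
have rchi : r * (chi / 2) = chi - 1 by rewrite /r; field; lra.
have c_gt0 : 0 < chi / 2 by lra.
have r_gt0 : 0 < r by rewrite -(pmulr_lgt0 _ c_gt0) rchi; lra.
(* The cost [z] is admissible in the gap: [zub] and [Ichi] give [r] times its relaxed optimum at
   least [chi - 1 >= 1]. *)
have L_gt0 : 0 < min_cost z (vc_polyhedron e).
  by rewrite -(pmulr_rgt0 _ r_gt0); lra.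
apply: max_ofE => [|_ [c [c0 cL] <-]]; last by rewrite ler_pdivrMr// ub.
exists z => //; apply/eqP; rewrite eq_le ler_pdivrMr// zub ler_pdivlMr//=.
by apply: le_trans Ichi; rewrite -rchi ler_pM2l.
Qed.
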